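(* Let $\mathcal{E}$ be a basis of $\mathbb{R}^{n+1}$, let $\|\cdot\|$ be a norm on $\mathbb{R}^{n+1}$, and let $\alpha$ be the $(n+1)$-bonacci number, i.e. the root of largest modulus of $x^{n+1}=x^n+\cdots+x+1$. Then there exist real constants $A,B>0$ such that $$A\,|I|\le\|b_I\|\le B\,\alpha^{|I|}$$ for all multi-indices $I$.
   Context: For an ordered basis $\mathcal{E}=\{e_1,\dots,e_{n+1}\}$ of $\mathbb{R}^{n+1}$ and $j\in\{1,\dots,n+1\}$, $\mathcal{E}_j=\{e^j_1,\dots,e^j_{n+1}\}$ is the basis with $e^j_j=e_j$ and $e^j_i=e_i+e_j$ for $i\ne j$. For a multi-index $I=i_1i_2\cdots i_k$ with entries in $\{1,\dots,n+1\}$, $|I|=k$, define recursively $\mathcal{E}_{\emptyset}=\mathcal{E}$ and $\mathcal{E}_{i_1\cdots i_k}=(\mathcal{E}_{i_1\cdots i_{k-1}})_{i_k}$. The barycenter $b_I\in\mathbb{R}^{n+1}$ is the sum of the $n+1$ vectors of the basis $\mathcal{E}_I$.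
   Formalization: The formal statement assumes n ≥ 1; for n = 0 the claim fails, since then b_I = e_1 for every multi-index I and A|I| ≤ ‖b_I‖ cannot hold for all I. *)

(* Defs.v *)
From HB Require Import structures.
From mathcomp Require Import all_boot all_order all_algebra.
From mathcomp Require Import complex reals.

Set Implicit Arguments.
Unset Strict Implicit.
Unset Printing Implicit Defensive.

Import Order.TTheory GRing.Theory Num.Theory.
Local Open Scope ring_scope.
Local Open Scope complex_scope.

Definition is_norm (R : realType) (V : lmodType R) (N : V -> R) : Prop :=
  [/\ forall x y, N (x + y) <= N x + N y,
      forall (a : R) x, N (a *: x) = `|a| * N x
    & forall x, N x = 0 -> x = 0].

(* An ordered basis is a tuple of vectors; indices are shifted to start at 0. *)
Definition basis_step (V : zmodType) (m : nat) (E : m.-tuple V) (j : 'I_m) :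
    m.-tuple V :=
  [tuple if i == j then tnth E j else tnth E i + tnth E j | i < m].

Definition basis_at (V : zmodType) (m : nat) (E : m.-tuple V)
    (I : seq 'I_m) : m.-tuple V :=
  foldl (@basis_step V m) E I.

Definition barycenter (V : zmodType) (m : nat) (E : m.-tuple V)
    (I : seq 'I_m) : V :=
  \sum_(i < m) tnth (basis_at E I) i.

Definition bonacci_poly (F : nzRingType) (m : nat) : {poly F} :=
  'X^m - \sum_(i < m) 'X^i.

(* The comparison ranges over all complex roots; `|z| is the modulus, seen as
   an element of R[i]. *)
Definition is_bonacci (R : realType) (m : nat) (alpha : R) : Prop :=
  root (bonacci_poly R[i] m) alpha%:C /\
  forall z : R[i], root (bonacci_poly R[i] m) z -> `|z| <= `|alpha%:C|.

Lemma root_bonacci (F : fieldType) (m : nat) (x : F) :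
  root (bonacci_poly F m) x = (x ^+ m == \sum_(i < m) x ^+ i).
Proof.
rewrite rootE /bonacci_poly hornerD hornerN hornerXn horner_sum subr_eq0.
by under eq_bigr do rewrite hornerXn.
Qed.

Lemma bonacci_exists (R : realType) (m : nat) :
  (0 < m)%N -> exists alpha : R, is_bonacci m alpha.
Proof.
move=> m0.
have [||b /andP[b1 _]] := @poly_ivt R (bonacci_poly R m) 1 2.
- by rewrite ler1n.
- rewrite /bonacci_poly !hornerD !hornerN !hornerXn !horner_sum.
  under eq_bigr do rewrite hornerXn expr1n.
  under [in X in _ && X]eq_bigr do rewrite hornerXn.
  rewrite sumr_const card_ord expr1n subr_le0 ler1n m0 subr_ge0 /=.
  have := subrX1 (2 : R) m; rewrite (_ : 2 - 1 = 1 :> R); last first.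
    exact: addrK.
  by rewrite mul1r => <-; rewrite lerBlDr lerDl ler01.
rewrite root_bonacci => /eqP bE.
have b0 : 0 < b := lt_le_trans ltr01 b1.
exists b; split.
  by rewrite root_bonacci -rmorphXn bE rmorph_sum; apply/eqP/eq_bigr=> i _;
     rewrite rmorphXn.
move=> z; rewrite root_bonacci => /eqP zE.
have [r r0 rE] : exists2 r : R, 0 <= r & `|z| = r%:C.
  case: z {zE} => x y; exists (Num.sqrt (x ^+ 2 + y ^+ 2)) => //.
  exact: sqrtr_ge0.
have : `|z| ^+ m <= \sum_(i < m) `|z| ^+ i.
  rewrite -normrX zE (le_trans (ler_norm_sum _ _ _))//.
  by apply: ler_sum => i _; rewrite normrX.
rewrite rE -rmorphXn; under eq_bigr do rewrite -rmorphXn.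
rewrite -rmorph_sum lecR => rm.
rewrite (ger0_norm (_ : 0 <= b%:C)) ?lecR ?(ltW b0)// leNgt; apply/negP => br.
have t1 : 1 < r / b by rewrite ltr_pdivlMr ?mul1r.
have rb : r = r / b * b by rewrite divfK ?gt_eqF.
move: rm; rewrite leNgt => /negP; apply.
rewrite {2}rb exprMn bE mulr_sumr; apply: ltr_sum.
  by apply/hasP; exists (Ordinal m0); rewrite ?mem_index_enum.
move=> i _; rewrite {1}rb exprMn ltr_pM2r ?exprn_gt0//.
by rewrite ltr_eXn2l.
Qed.

(* Main.v *)
(** Upper bound: weight the basis vectors by a permutation of
    [1, alpha, ..., alpha^n]. Since [1 + alpha + ... + alpha^n = alpha^(n+1)],
    passing from [E] to [E_j] amounts to replacing the weights by [alpha] times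
    another permutation of these powers, at most, so that the weighted sum of
    the norms grows by a factor at most [alpha] at each step.

    Lower bound: the sum of the coordinates in the initial basis is an additive
    functional which is at least 1 on every vector of every [E_I], hence grows
    by at least 1 at each step on [b_I]; being linear, it is bounded by a
    multiple of the norm. *)
Require Import Defs.
From mathcomp Require Import all_boot all_order all_algebra.
From mathcomp Require Import complex reals.
From mathcomp Require Import boolp classical_sets topology normedtype derive.
From mathcomp Require Import zify ring lra.

Set Implicit Arguments.
Unset Strict Implicit.
Unset Printing Implicit Defensive.

Import Order.TTheory GRing.Theory Num.Theory.
Import numFieldNormedType.Exports.
Local Open Scope ring_scope.

Lemma basis_at_rcons (V : zmodType) (m : nat) (E : m.-tuple V)
    (I : seq 'I_m) (j : 'I_m) :
  basis_at E (rcons I j) = basis_step (basis_at E I) j.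
Proof. by rewrite /basis_at foldl_rcons. Qed.

(** Multiplying the sum by [x - 1] telescopes it, so [x ^+ m * (x - 1) = x ^+ m - 1]. In this closed
    form the sign of a real root can be read off. *)
Lemma bonacci_root_mul (R : comNzRingType) (m : nat) (x : R) :
  x ^+ m = \sum_(i < m) x ^+ i -> x ^+ m * (2 - x) = 1.
Proof.
move=> xE; have := subrX1 x m; rewrite -xE => h.
by rewrite -[RHS](subKr (x ^+ m)) h; ring.
Qed.

Lemma bonacci_real_root (R : realType) (m : nat) (alpha : R) :
  is_bonacci m alpha -> alpha ^+ m = \sum_(i < m) alpha ^+ i.
Proof.
case; rewrite root_bonacci -rmorphXn /=.
under eq_bigr do rewrite -rmorphXn /=.
by rewrite -rmorph_sum => /eqP /complexI.
Qed.

(** [is_bonacci] controls only the modulus of [alpha]. A real root in [1, 2] forces this modulus to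
    be at least 1; the sign is settled separately. *)
Lemma bonacci_ge1 (R : realType) (m : nat) (alpha : R) :
  (0 < m)%N -> is_bonacci m alpha -> 1 <= alpha.
Proof.
move=> m0 ha; have /bonacci_root_mul aE := bonacci_real_root ha.
have [||b /andP[b1 _]] := @poly_ivt R (bonacci_poly R m) 1 2.
- by rewrite ler1n.
(* The polynomial takes the value 1 - m <= 0 at 1 and 2^m - (2^m - 1) = 1 at 2. *)
- rewrite /bonacci_poly !hornerD !hornerN !hornerXn !horner_sum.
  under eq_bigr do rewrite hornerXn expr1n.
  under [in X in _ && X]eq_bigr do rewrite hornerXn.
  rewrite sumr_const card_ord expr1n subr_le0 ler1n m0 subr_ge0 /=.
  have := subrX1 (2 : R) m; rewrite (_ : 2 - 1 = 1 :> R); last by ring.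
  by rewrite mul1r => <-; rewrite lerBlDr lerDl ler01.
rewrite root_bonacci => /eqP bE.
have rb : root (bonacci_poly R[i] m) b%:C%C.
  rewrite root_bonacci -rmorphXn /= bE rmorph_sum.
  by apply/eqP/eq_bigr => i _; rewrite rmorphXn.
have [_ /(_ _ rb)] := ha.
rewrite !normc_def /= !expr0n /= !addr0 !sqrtr_sqr lecR => ba.
have a1 : 1 <= `|alpha| by apply: le_trans ba; rewrite ger0_norm; lra.
have [a0|a0] := lerP 0 alpha; first by rewrite -(ger0_norm a0).
(* A negative root of modulus at least 1 would make [alpha^m (2 - alpha) = 1]
   larger than 1 in modulus. *)
have : 1 < `|alpha ^+ m * (2 - alpha)|.
  rewrite normrM normrX (ger0_norm (_ : 0 <= 2 - alpha)); last lra.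
  have : 1 <= `|alpha| ^+ m by exact: exprn_ege1.
  nra.
by rewrite aE normr1 ltxx.
Qed.

Lemma bonacci_weight_step (R : realFieldType) (n : nat) (alpha : R)
    (a : 'I_n.+1 -> R) (j : 'I_n.+1) (sigma : 'I_n.+1 -> 'I_n.+1) :
    1 <= alpha -> alpha ^+ n.+1 = \sum_(i < n.+1) alpha ^+ i ->
    (forall i, 0 <= a i) -> injective sigma ->
  exists2 tau : 'I_n.+1 -> 'I_n.+1, injective tau &
    \sum_i alpha ^+ sigma i * (if i == j then a j else a i + a j) <=
    alpha * \sum_i alpha ^+ tau i * a i.
Proof.
move=> a1 aE a0 sI.
(* [a j] gathers the total weight [alpha^(n+1)]; the weights above the lost
   [alpha^(sigma j)] move down by one so as to fill the gap it leaves. *)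
pose tau i : 'I_n.+1 := if i == j then ord_max else
  if (sigma i < sigma j)%N then sigma i else inord (sigma i).-1.
have sD i : i != j -> nat_of_ord (sigma i) <> nat_of_ord (sigma j).
  by move=> /eqP ij /val_inj /sI.
have tauE i : tau i = (if i == j then n else
    if (sigma i < sigma j)%N then nat_of_ord (sigma i) else (sigma i).-1) :> nat.
  rewrite /tau; case: eqP => // _; case: ifP => // _.
  by rewrite inordK //; have := ltn_ord (sigma i); lia.
exists tau.
  move=> i k /(congr1 (@nat_of_ord _)); rewrite !tauE.
  have := ltn_ord (sigma i); have := ltn_ord (sigma k).
  have := ltn_ord (sigma j).
  case: eqP => [->|/eqP/sD ij]; case: eqP => [->|/eqP/sD kj] //.
  - by case: ifP; lia.
  - by case: ifP; lia.
  - move=> h1 h2 h3 h; apply/sI/val_inj => /=.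
    by move: h; case: ifP; case: ifP; lia.
have -> : \sum_i alpha ^+ sigma i * (if i == j then a j else a i + a j) =
    alpha ^+ n.+1 * a j + \sum_(i | i != j) alpha ^+ sigma i * a i.
  have -> : alpha ^+ n.+1 = \sum_i alpha ^+ sigma i.
    by rewrite aE (reindex_inj sI).
  rewrite mulr_suml (bigD1 j) //= eqxx [in RHS](bigD1 j) //=.
  rewrite -addrA -big_split /=; congr (_ + _); apply: eq_bigr => i /negPf ->.
  by rewrite mulrDr addrC.
(* The terms at [j] agree because [tau j = n]; elsewhere [sigma i <= tau i + 1]. *)
rewrite mulr_sumr [leRHS](bigD1 j) //= mulrA -exprS tauE eqxx lerD2l.
apply: ler_sum => i ij; rewrite mulrA -exprS ler_wpM2r // ler_weXn2l //.
by rewrite tauE (negPf ij); have := sD _ ij; case: ifP; lia.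
Qed.

Section Seminorm.
Context (R : realType) (V : lmodType R) (N : V -> R).
Hypothesis ND : forall x y, N (x + y) <= N x + N y.
Hypothesis NZ : forall (a : R) x, N (a *: x) = `|a| * N x.

Lemma seminorm0 : N 0 = 0.
Proof. by rewrite -(scale0r 0) NZ normr0 mul0r. Qed.

Lemma seminormN x : N (- x) = N x.
Proof. by rewrite -scaleN1r NZ normrN1 mul1r. Qed.

Lemma seminorm_ge0 x : 0 <= N x.
Proof. by have := ND x (- x); rewrite subrr seminorm0 seminormN; lra. Qed.

Lemma seminorm_sum m (F : 'I_m -> V) : N (\sum_i F i) <= \sum_i N (F i).
Proof.
elim/big_rec2: _ => [|i y x _ h]; first by rewrite seminorm0.
by apply: le_trans (ND _ _) _; rewrite lerD2l.
Qed.

(** Induction on [I] from the right, for all [sigma] at once, since each step trades [sigma] for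
    another permutation [tau]. Initially every weight is at most [alpha ^+ n]. *)
Lemma weighted_seminorm_basis_at n (alpha : R) (E : n.+1.-tuple V)
    (I : seq 'I_n.+1) (sigma : 'I_n.+1 -> 'I_n.+1) :
    1 <= alpha -> alpha ^+ n.+1 = \sum_(i < n.+1) alpha ^+ i ->
    injective sigma ->
  \sum_i alpha ^+ sigma i * N (tnth (basis_at E I) i) <=
  alpha ^+ size I * (alpha ^+ n * \sum_i N (tnth E i)).
Proof.
move=> a1 aE; elim/last_ind: I sigma => [|I j IH] sigma sI.
  rewrite mul1r mulr_sumr; apply: ler_sum => i _.
  by rewrite ler_wpM2r ?seminorm_ge0 // ler_weXn2l // -ltnS.
have [tau tI h] := @bonacci_weight_step R n alpha
  (fun i => N (tnth (basis_at E I) i)) j sigma a1 aE (fun=> seminorm_ge0 _) sI.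
rewrite size_rcons exprS -mulrA.
apply: (@le_trans _ _ (alpha * \sum_i alpha ^+ tau i *
  N (tnth (basis_at E I) i))); last first.
  by apply: ler_wpM2l; [lra | exact: IH].
apply: le_trans h; apply: ler_sum => i _.
rewrite ler_wpM2l ?exprn_ge0 //; first lra.
by rewrite basis_at_rcons tnth_mktuple; case: eqP.
Qed.

Lemma seminorm_barycenter_le n (alpha : R) (E : n.+1.-tuple V)
    (I : seq 'I_n.+1) :
    1 <= alpha -> alpha ^+ n.+1 = \sum_(i < n.+1) alpha ^+ i ->
  N (barycenter E I) <= alpha ^+ size I * (alpha ^+ n * \sum_i N (tnth E i)).
Proof.
move=> a1 aE; apply: le_trans (seminorm_sum _) _.
(* All weights are at least 1, so inserting them, with [sigma] the identity, only increases the
   sum. *)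
apply: le_trans (weighted_seminorm_basis_at E I a1 aE (fun _ _ => id)).
apply: ler_sum => i _; rewrite -[leLHS]mul1r ler_wpM2r ?seminorm_ge0 //.
exact: exprn_ege1.
Qed.

End Seminorm.

Lemma sum_basis_at_ge (R : numDomainType) (V : zmodType) (n : nat)
    (E : n.+1.-tuple V) (f : V -> R) (I : seq 'I_n.+1) :
    (0 < n)%N -> {morph f : x y / x + y} -> (forall i, 1 <= f (tnth E i)) ->
  (size I)%:R <= \sum_i f (tnth (basis_at E I) i).
Proof.
move=> n0 fD fE.
have f1 J i : 1 <= f (tnth (basis_at E J) i).
  elim/last_ind: J i => [|J j IH] i //.
  rewrite basis_at_rcons tnth_mktuple; case: ifP => // _.
  by rewrite fD (le_trans (IH i)) // lerDl (le_trans ler01).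
elim/last_ind: I => [|I j IH].
  by rewrite sumr_ge0 // => i _; rewrite (le_trans ler01).
rewrite size_rcons -natr1.
pose a i := f (tnth (basis_at E I) i).
have -> : \sum_i f (tnth (basis_at E (rcons I j)) i) =
    \sum_i a i + \sum_(i | i != j) a j.
  rewrite [X in _ + X]big_mkcond -big_split /=; apply: eq_bigr => i _.
  rewrite basis_at_rcons tnth_mktuple; case: eqP => [->|_] /=.
    by rewrite addr0.
  by rewrite fD.
(* The step adds [n] copies of [a j >= 1], and [n] is positive. *)
rewrite lerD // sumr_const cardC1 card_ord -(prednK n0) mulrS.
by rewrite ler_wpDr ?f1 // mulrn_wge0 // (le_trans ler01 (f1 _ _)).
Qed.

(** Expand [x] in the canonical basis; the sup norm bounds each coordinate. This serves both for a
    norm and for the absolute value of a linear functional. The summand 1 in the constant keeps it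
    positive. *)
Lemma seminorm_le_mx_norm (R : realType) (n : nat) (N : 'rV[R]_n -> R) :
    (forall x y, N (x + y) <= N x + N y) ->
    (forall (a : R) x, N (a *: x) = `|a| * N x) ->
  exists2 K : R, 0 < K & forall x, N x <= K * `|x|.
Proof.
move=> ND NZ.
have Nge0 := seminorm_ge0 ND NZ.
exists (1 + \sum_(i < n) N (delta_mx 0 i)).
  by rewrite ltr_wpDr // sumr_ge0.
move=> x; apply: (@le_trans _ _ (\sum_(i < n) `|x 0 i| * N (delta_mx 0 i))).
  rewrite {1}(row_sum_delta x); apply: le_trans (seminorm_sum ND NZ _) _.
  by apply: ler_sum => i _; rewrite NZ.
rewrite mulrDl mul1r ler_wpDl // mulr_suml; apply: ler_sum => i _.
rewrite mulrC ler_wpM2l //.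
rewrite [leRHS]/Num.norm /= mx_normrE; apply/bigmax_geP; right => /=.
by exists (0, i).
Qed.

(** [N] is Lipschitz for the sup norm, hence attains a minimum on the compact unit sphere.
    Definiteness makes this minimum positive, and homogeneity extends the bound to all vectors. *)
Lemma mx_norm_le_norm (R : realType) (n : nat) (N : 'rV[R]_n.+1 -> R) :
  is_norm N -> exists2 c : R, 0 < c & forall x, c * `|x| <= N x.
Proof.
move=> NP; have [ND NZ Neq0] := NP.
have [K K0 NK] := seminorm_le_mx_norm ND NZ.
have Ncont : continuous N.
  move=> x; apply/(@cvgrPdist_lt _ _ _ (nbhs x) (nbhs_filter x)) => e e0.
  near=> y.
  apply: (@le_lt_trans _ _ (K * `|x - y|)).
    apply: le_trans (NK _); rewrite ler_norml; apply/andP; split.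
      have := ND (y - x) x; rewrite subrK -(seminormN NZ (x - y)) opprB.
      lra.
    by have := ND (x - y) y; rewrite subrK; lra.
  rewrite -ltr_pdivlMl // mulrC; near: y.
  by apply: cvgr_dist_lt; [exact: cvg_id | rewrite divr_gt0].
pose S := [set x : 'rV[R]_n.+1 | `|x| = 1]%classic.
have Scompact : compact S.
  apply: bounded_closed_compact.
    exists 1; split=> // M M1 x /= ->; exact: ltW.
  rewrite (_ : S = (fun x => `|x|) @^-1` [set 1])%classic //.
  apply: closed_comp; last exact: closed_eq.
  by move=> x _; exact: norm_continuous.
have Snonempty : (S !=set0)%classic.
  exists (`|const_mx 1 : 'rV[R]_n.+1|^-1 *: const_mx 1).
  rewrite /S /= normrZ normfV normr_id mulVf // normr_eq0.
  by apply/eqP => /rowP /(_ 0); rewrite !mxE => /eqP; rewrite oner_eq0.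
have [|c cS cmin] := @compact_EVT_min _ R N S Snonempty Scompact.
  exact: continuous_subspaceT.
move: cS; rewrite inE /S /= => c1.
exists (N c).
  rewrite lt_def (seminorm_ge0 ND NZ) andbT; apply/eqP => /Neq0 c0.
  by move: c1; rewrite c0 normr0 => /eqP; rewrite eq_sym oner_eq0.
move=> x; have [->|x0] := eqVneq x 0.
  by rewrite normr0 mulr0 (seminorm_ge0 ND NZ).
have nx : 0 < `|x| by rewrite normr_gt0.
have := cmin (`|x|^-1 *: x); rewrite inE /S /= normrZ normfV normr_id.
rewrite mulVf ?gt_eqF // NZ normfV normr_id => /(_ erefl).
by rewrite ler_pdivlMl // mulrC.
Unshelve. all: by end_near.
Qed.

Theorem theorem3 (R : realType) (n : nat) (hn : (0 < n)%N)
    (E : n.+1.-tuple 'rV[R]_n.+1) (hE : basis_of fullv E)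
    (N : 'rV[R]_n.+1 -> R) (hN : is_norm N)
    (alpha : R) (halpha : is_bonacci n.+1 alpha) :
  exists A B : R, [/\ 0 < A, 0 < B &
    forall I : seq 'I_n.+1,
      A * (size I)%:R <= N (barycenter E I) <= B * alpha ^+ size I].
Proof.
have [ND NZ _] := hN.
have a1 : 1 <= alpha by exact: bonacci_ge1 halpha.
have aE := bonacci_real_root halpha.
pose f v := \sum_i coord E i v.
have fD : {morph f : x y / x + y}.
  by move=> x y; rewrite /f -big_split; apply: eq_bigr => i _; rewrite raddfD.
have fZ a x : f (a *: x) = a * f x.
  by rewrite /f mulr_sumr; apply: eq_bigr => i _; rewrite linearZ.
have fE i : 1 <= f (tnth E i).
  rewrite /f (bigD1 i) //= (tnth_nth 0) coord_free ?(basis_free hE) // eqxx.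
  rewrite lerDl sumr_ge0 // => k _.
  by rewrite coord_free ?(basis_free hE) // ler0n.
have fsum m (F : 'I_m -> 'rV[R]_n.+1) : f (\sum_i F i) = \sum_i f (F i).
  apply: (big_morph _ fD).
  by rewrite /f big1 // => i _; rewrite linear0.
have [K K0 fK] : exists2 K : R, 0 < K & forall x, `|f x| <= K * `|x|.
  apply: seminorm_le_mx_norm => [x y|a x]; first by rewrite fD ler_normD.
  by rewrite fZ normrM.
have [c c0 Nc] := mx_norm_le_norm hN.
(* Lower constant: [|I| <= f b_I <= K * |b_I|] and [c * |b_I| <= N b_I], with [|b_I|] the sup norm.
   Adding 1 makes the upper constant visibly positive. *)
exists (c / K), (alpha ^+ n * \sum_i N (tnth E i) + 1).
have S0 : 0 <= alpha ^+ n * \sum_i N (tnth E i).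
  rewrite mulr_ge0 ?exprn_ge0 ?sumr_ge0 //; first lra.
  by move=> i _; exact: seminorm_ge0.
split; [exact: divr_gt0 | lra |] => I; apply/andP; split.
  apply: le_trans (Nc _); rewrite -mulrA ler_pM2l // ler_pdivrMl //.
  apply: le_trans (fK _); apply: le_trans (ler_norm _).
  by rewrite /barycenter fsum; exact: sum_basis_at_ge.
apply: le_trans (seminorm_barycenter_le ND NZ E I a1 aE) _.
rewrite mulrC ler_wpM2r ?exprn_ge0 //; lra.
Qed.
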